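(* Let $N\ge 2$ and let $\{T^{(n)}\}_{n\in\mathbb N}$ be a sequence of $N\times N$ stochastic matrices with positive entries. The following statements are equivalent: (i) For all $x_1x_2\dots\in\mathcal K_N$, $$\sum_{n=1}^\infty\left|\frac{T^{(n)}_{x_n,x_{n+1}}}{T^{(n+1)}_{x_n,x_{n+1}}}-1\right|<\infty.$$ (ii) For all $i,j\in\mathbb Z_N$, $$\sum_{n=1}^\infty\left|\frac{T^{(n)}_{i,j}}{T^{(n+1)}_{i,j}}-1\right|<\infty.$$ (iii) For all $i,j\in\mathbb Z_N$, $$\sum_{n=1}^\infty\left|T^{(n)}_{i,j}-T^{(n+1)}_{i,j}\right|<\infty\quad\text{and}\quad \inf_n T^{(n)}_{i,j}>0.$$ Moreover, under these (equivalent) conditions, the matrices $T^{(n)}$ converge to a stochastic matrix $T^{(\infty)}$ with positive entries.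
   Context: $\mathbb N=\{1,2,\dots\}$, $\mathbb Z_N=\{0,1,\dots,N-1\}$, and $\mathcal K_N=\mathbb Z_N^{\mathbb N}$ is the set of all infinite words $x_1x_2\dots$ with letters in $\mathbb Z_N$. An $N\times N$ matrix, with rows and columns indexed by $\mathbb Z_N$, is stochastic if the sum of the entries in each row is $1$. Convergence of matrices is entrywise. *)

(* Defs.v *)
From HB Require Import structures.
From mathcomp Require Import all_boot all_order all_algebra.
From mathcomp Require Import all_classical all_reals all_analysis.

Set Implicit Arguments.
Unset Strict Implicit.
Unset Printing Implicit Defensive.

Import Order.TTheory GRing.Theory Num.Theory.
Import numFieldNormedType.Exports.

Local Open Scope classical_set_scope.
Local Open Scope ring_scope.

(* Nonnegativity of the entries is not part of this notion: positivity is
   always required separately, through [positive_mx]. *)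
Definition stochastic (R : realType) (N : nat) (A : 'M[R]_N) : Prop :=
  forall i, \sum_j A i j = 1.

Definition positive_mx (R : realType) (N : nat) (A : 'M[R]_N) : Prop :=
  forall i j, 0 < A i j.

(* Infinite words x_1 x_2 ... over Z_N = {0, ..., N-1}; the letter x_(n+1) is
   [x n].  Matrix sequences are shifted likewise: [T n] is T^(n+1). *)
Definition word (N : nat) : Type := nat -> 'I_N.

(* The sum of |u n| over all n is finite, as an extended real. *)
Definition abs_summable (R : realType) (u : nat -> R) : Prop :=
  (\sum_(0 <= n <oo) (`|u n|)%:E < +oo)%E.

Definition ratio_summable_along_words (R : realType) (N : nat)
    (T : nat -> 'M[R]_N) : Prop :=
  forall x : word N,
    abs_summable
      (fun n => T n (x n) (x n.+1) / T n.+1 (x n) (x n.+1) - 1).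

Definition ratio_summable_entrywise (R : realType) (N : nat)
    (T : nat -> 'M[R]_N) : Prop :=
  forall i j : 'I_N, abs_summable (fun n => T n i j / T n.+1 i j - 1).

Definition bounded_variation_inf_pos (R : realType) (N : nat)
    (T : nat -> 'M[R]_N) : Prop :=
  forall i j : 'I_N,
    abs_summable (fun n => T n i j - T n.+1 i j) /\
    0 < inf [set T n i j | n in [set: nat]].

Definition cvg_entrywise (R : realType) (N : nat)
    (T : nat -> 'M[R]_N) (A : 'M[R]_N) : Prop :=
  forall i j : 'I_N, (fun n => T n i j) @ \oo --> A i j.

(* Main.v *)
(* Only the two words ijij... and jiji... are needed for (i) => (ii): at every n
   one of them passes through the transition (i, j).
   For (ii) => (iii), put r_n := t_n / t_(n+1) - 1. Telescoping
   t_n = (1 + r_n) t_(n+1) <= exp |r_n| t_(n+1) gives t_0 <= exp (sum |r_n|) t_n,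
   a positive lower bound, and |t_n - t_(n+1)| = |r_n| t_(n+1) <= |r_n| since
   the entries of a positive stochastic matrix are at most 1. *)
Require Import Defs.
From mathcomp Require Import all_boot all_order all_algebra.
From mathcomp Require Import all_classical all_reals all_analysis.

Set Implicit Arguments.
Unset Strict Implicit.
Unset Printing Implicit Defensive.

Import Order.TTheory GRing.Theory Num.Theory.
Import numFieldNormedType.Exports.

Local Open Scope classical_set_scope.
Local Open Scope ring_scope.

(** Partial sums of nonnegative terms increase, so finiteness of the extended-real series amounts to
    a uniform real bound; the comparisons below work with that bound. *)
Lemma abs_summableP (R : realType) (u : nat -> R) :
  abs_summable u <-> exists M : R, forall n, \sum_(0 <= k < n) `|u k| <= M.
Proof.
rewrite /abs_summable; split=> [ufin|[M uM]].
  exists (fine (\sum_(0 <= n <oo) `|u n|%:E)%E) => n.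
  rewrite -lee_fin fineK.
    by rewrite -sumEFin; apply: nneseries_lim_ge => k _ _; rewrite lee_fin.
  by rewrite ge0_fin_numE //; apply: nneseries_ge0 => k _ _; rewrite lee_fin.
apply: (@le_lt_trans _ _ M%:E); last exact: ltry.
apply: lime_le.
  by apply: is_cvg_nneseries => k _ _; rewrite lee_fin.
by apply: nearW => n; rewrite sumEFin lee_fin.
Qed.

Lemma abs_summable_le (R : realType) (C : R) (u v : nat -> R) :
  0 <= C -> (forall n, `|u n| <= C * `|v n|) -> abs_summable v -> abs_summable u.
Proof.
move=> C0 uv /abs_summableP[M vM]; apply/abs_summableP; exists (C * M) => n.
by apply: le_trans (ler_wpM2l C0 (vM n)); rewrite mulr_sumr; apply: ler_sum.
Qed.

(** The finite sum over [I] exchanges with partial sums, so bounds for the [v i] add up. This passes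
    between words and entries in both directions. *)
Lemma abs_summable_sum (R : realType) (I : finType) (u : nat -> R)
    (v : I -> nat -> R) :
  (forall n, `|u n| <= \sum_i `|v i n|) -> (forall i, abs_summable (v i)) ->
  abs_summable u.
Proof.
move=> uv sv; have {}sv i := (abs_summableP (v i)).1 (sv i).
have [M vM] := choice sv.
apply/abs_summableP; exists (\sum_i M i) => n.
apply: (@le_trans _ _ (\sum_(0 <= k < n) \sum_i `|v i k|)); first exact: ler_sum.
by rewrite exchange_big; apply: ler_sum.
Qed.

(** The sequence is [t 0] plus the series of its increments, and that series converges
    absolutely. *)
Lemma abs_summable_diff_is_cvg (R : realType) (t : nat -> R) :
  abs_summable (fun n => t n - t n.+1) -> cvgn t.
Proof.
move=> /abs_summableP[M tM].
have ct : cvgn (series (telescope t)).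
  have nd : nondecreasing_seq (fun n => \sum_(0 <= k < n) `|telescope t k|).
    exact: nondecreasing_series.
  apply: normed_cvg; apply: (nondecreasing_is_cvgn nd).
  exists M => _ [n _ <-]; apply: le_trans (tM n).
  by apply: ler_sum => k _; rewrite distrC.
have -> : t = (fun n => t 0%N + series (telescope t) n).
  by apply/funext => n; exact: eq_sum_telescope.
by apply: is_cvgD => //; exact: is_cvg_cst.
Qed.

Lemma ratio_summable_lower_bound (R : realType) (t : nat -> R) :
  (forall n, 0 < t n) -> abs_summable (fun n => t n / t n.+1 - 1) ->
  exists2 c, 0 < c & forall n, c <= t n.
Proof.
move=> t0 /abs_summableP[M rM].
exists (t 0%N * expR (- M)) => [|n]; first by rewrite mulr_gt0 ?expR_gt0.
rewrite expRN ler_pdivrMr ?expR_gt0 //.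
suff /le_trans : t 0%N <= t n * expR (\sum_(0 <= k < n) `|t k / t k.+1 - 1|).
  by apply; rewrite ler_wpM2l ?ler_expR // ltW.
elim: n => [|n IH]; first by rewrite big_geq // expR0 mulr1.
apply: (le_trans IH); rewrite big_nat_recr //= addrC expRD mulrA.
rewrite ler_wpM2r ?expR_ge0 //.
(* With r = t n / t n.+1 - 1, the intermediate bound comes from r <= |r|, and 1 + |r| <= exp |r|
   finishes. *)
apply: (@le_trans _ _ (t n.+1 * (1 + `|t n / t n.+1 - 1|))); last first.
  by rewrite ler_wpM2l ?expR_ge1Dx // ltW.
rewrite -ler_pdivrMl // mulrC -lerBlDl; exact: ler_norm.
Qed.

(** Positivity supplies the lower bound 0, which makes [inf] a genuine infimum rather than a default
    value. *)
Lemma ge_inf_pos (R : realType) (t : nat -> R) :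
  (forall n, 0 < t n) -> forall n, inf [set t n | n in [set: nat]] <= t n.
Proof.
by move=> t0 n; apply: ge_inf; [exists 0 => _ [k _ <-]; exact: ltW|exists n].
Qed.

Lemma positive_stochastic_le1 (R : realType) (N : nat) (A : 'M[R]_N) :
  stochastic A -> positive_mx A -> forall i j, A i j <= 1.
Proof.
move=> sA pA i j; rewrite -(sA i) (bigD1 j) //= lerDl.
by apply: sumr_ge0 => k _; exact: ltW.
Qed.

Lemma ratio_words_entrywise (R : realType) (N : nat) (T : nat -> 'M[R]_N) :
  ratio_summable_along_words T <-> ratio_summable_entrywise T.
Proof.
split=> [wT i j|eT x].
  (* Since parity alternates, the word [x (odd n)] reads [i] at n and [j] at n.+1. *)
  pose x (b : bool) : word N := fun n => if odd n == b then i else j.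
  apply: (@abs_summable_sum _ bool _ _ _ (fun b => wT (x b))) => n.
  rewrite (bigD1 (odd n)) //= /x /= eqxx.
  by case: (odd n); rewrite /= lerDl sumr_ge0.
(* Each term along a word occurs at the same n in the series of the pair (x n, x n.+1), so the sum
   over all pairs dominates. *)
apply: (@abs_summable_sum _ ('I_N * 'I_N)%type _ _ _ (fun p => eT p.1 p.2)) => n.
by rewrite (bigD1 (x n, x n.+1)) //= lerDl sumr_ge0.
Qed.

Lemma ratio_entrywise_bounded_variation (R : realType) (N : nat)
    (T : nat -> 'M[R]_N) (hstoch : forall n, stochastic (T n))
    (hpos : forall n, positive_mx (T n)) :
  ratio_summable_entrywise T <-> bounded_variation_inf_pos T.
Proof.
have ratioE i j n : T n i j / T n.+1 i j - 1 = (T n i j - T n.+1 i j) / T n.+1 i j.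
  by rewrite mulrBl divff // gt_eqF ?hpos.
split=> [eT i j|bT i j].
  split.
    apply: (abs_summable_le ler01) (eT i j) => n.
    rewrite mul1r ratioE normrM normfV (gtr0_norm (hpos _ _ _)).
    by rewrite ler_peMr // invf_ge1 ?hpos ?positive_stochastic_le1.
  have [c c0 cT] := ratio_summable_lower_bound (fun n => hpos n i j) (eT i j).
  apply: (lt_le_trans c0); apply: lb_le_inf; first by exists (T 0%N i j); exists 0%N.
  by move=> _ [n _ <-].
have [dT m0] := bT i j; set m := inf _ in m0.
(* The denominator [T n.+1 i j] is at least the infimum [m], whence the factor [m^-1]. *)
apply: (@abs_summable_le _ m^-1) dT => [|n]; first by rewrite invr_ge0 ltW.
rewrite ratioE normrM normfV (gtr0_norm (hpos _ _ _)) mulrC.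
rewrite ler_wpM2r // lef_pV2 ?posrE ?hpos //.
by apply: ge_inf_pos => k; exact: hpos.
Qed.

Lemma bounded_variation_cvg (R : realType) (N : nat)
    (T : nat -> 'M[R]_N) (hstoch : forall n, stochastic (T n))
    (hpos : forall n, positive_mx (T n)) :
  bounded_variation_inf_pos T ->
  exists Tinf : 'M[R]_N,
    cvg_entrywise T Tinf /\ stochastic Tinf /\ positive_mx Tinf.
Proof.
move=> bT.
have cT i j : cvgn (fun n => T n i j).
  exact: abs_summable_diff_is_cvg (bT i j).1.
exists (\matrix_(i, j) limn (fun n => T n i j)); split; [|split] => [i j|i|i j].
- rewrite mxE; exact: cT.
(* Row sums are finite, so they commute with the limit and stay equal to 1. *)
- have cS : (fun n => \sum_j T n i j) @ \oo --> \sum_j limn (fun n => T n i j).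
    by apply: cvg_big => [|j _]; [exact: add_continuous|exact: cT].
  have sum1 : (fun n => \sum_j T n i j) = cst 1.
    by apply/funext => n; exact: hstoch.
  rewrite sum1 in cS; under eq_bigr do rewrite mxE.
  by move/cvg_lim: cS => <- //; exact: lim_cst.
(* The limit is at least the positive infimum, so strict positivity survives. *)
- have [_ m0] := bT i j; rewrite mxE; apply: (lt_le_trans m0).
  apply: limr_ge => //; apply: nearW => n.
  by apply: ge_inf_pos => k; exact: hpos.
Qed.

Theorem proposition3p3 (R : realType) (N : nat) (hN : (2 <= N)%N)
    (T : nat -> 'M[R]_N)
    (hstoch : forall n, stochastic (T n))
    (hpos : forall n, positive_mx (T n)) :
  (ratio_summable_along_words T <-> ratio_summable_entrywise T) /\
  (ratio_summable_entrywise T <-> bounded_variation_inf_pos T) /\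
  (ratio_summable_along_words T ->
     exists Tinf : 'M[R]_N,
       cvg_entrywise T Tinf /\ stochastic Tinf /\ positive_mx Tinf).
Proof.
split; first exact: ratio_words_entrywise.
split; first exact: ratio_entrywise_bounded_variation.
move=> /ratio_words_entrywise /(ratio_entrywise_bounded_variation hstoch hpos).
exact: bounded_variation_cvg.
Qed.
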